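(* Let $\mathcal{A}$ be a finite alphabet and $\mathcal{F}$ the free group over $\mathcal{A}$. Let $S \subseteq \mathcal{F}$ be product-free, i.e. there are no $x,y,z \in S$ (not necessarily distinct) with $z = x\cdot y$. Then $\bar{d}(S) \leq \frac{1}{2}$.
   Context: Every element $w\in\mathcal{F}$ is identified with its reduced word, and $|w|$ denotes the length of the reduced word. For $A\subseteq \mathcal{F}$ and $n\ge 1$, $A(n)=\{w\in A: |w|=n\}$ and $A_{\le n}=\{w\in A: |w|\le n\}$. The measure $\mu$ on $\mathcal{F}$ is defined by $\mu(\{w\}) = 1/|\mathcal{F}(|w|)| = \frac{1}{2|\mathcal{A}|(2|\mathcal{A}|-1)^{|w|-1}}$, so that each layer of words of a given length has total weight one. The upper asymptotic density is $\bar{d}(A)=\limsup_{n\to\infty}\frac{\mu(A_{\le n})}{\mu(\mathcal{F}_{\le n})}$. *)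

(* Defs.v *)
From mathcomp Require Import all_boot all_order all_algebra.
From mathcomp Require Import all_classical all_reals all_analysis.
Set Implicit Arguments. Unset Strict Implicit. Unset Printing Implicit Defensive.
Import Order.TTheory GRing.Theory Num.Theory.
Local Open Scope ring_scope.

(* Free group over the alphabet 'I_k (k generators).
   A letter is a pair (a, b): generator a, b = true meaning the inverse a^-1. *)
Definition letter (k : nat) := ('I_k * bool)%type.
Definition linv (k : nat) (x : letter k) : letter k := (x.1, ~~ x.2).

Definition reduced (k : nat) (s : seq (letter k)) : bool :=
  sorted (fun x y => y != linv x) s.

(* elements of the free group = reduced words; product = free reduction of
   concatenation *)
Definition cons_red (k : nat) (x : letter k) (w : seq (letter k)) :=
  if w is y :: w' then (if y == linv x then w' else x :: w) else [:: x].
Definition fmul (k : nat) (u v : seq (letter k)) : seq (letter k) :=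
  foldr (@cons_red k) v u.

Definition layer (k n : nat) (A : set (seq (letter k))) : {set n.-tuple (letter k)} :=
  [set t : n.-tuple (letter k) | reduced t && `[< A (tval t) >]].

(* mu(A_{<= n}) where mu({w}) = 1/|F(|w|)| *)
Definition mu_le (R : realType) (k : nat) (A : set (seq (letter k))) (n : nat) : R :=
  \sum_(m < n.+1) (#|layer m A|%:R / #|layer m (@setT (seq (letter k)))|%:R).

Definition upper_density (R : realType) (k : nat) (A : set (seq (letter k))) : \bar R :=
  limn_esup (fun n => (mu_le R A n / mu_le R (@setT (seq (letter k))) n)%:E).

Definition product_free (k : nat) (S : set (seq (letter k))) : Prop :=
  forall x y z, S x -> S y -> S z -> z <> fmul x y.

(* Main.v *)
Require Import Defs.
From mathcomp Require Import all_boot all_order all_algebra.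
From mathcomp Require Import all_classical all_reals all_analysis.
From mathcomp Require Import ring lra.

(** Fix a letter [c] and read a uniformly random infinite reduced word [w] that
    starts with [c]. Call a prefix [x] in S that is followed by the letter [c]
    a hit. At the first hit, [w = x w'] where [w'] has the same law as [w], and
    by product-freeness a prefix [w'_n] of [w'] and [x w'_n] are not both in S,
    so after a hit the expected density [d] of S along [w] satisfies
    [d <= 1 - d]. If [w] is never hit, then almost surely all but finitely many
    of its prefixes in S end in [c^-1], because any other prefix is followed by
    [c] with probability 1/(2k-1); the prefixes ending in [c^-1] have density
    1/(2k), which is at most 1/2. With [p] the probability of a hit this gives
    [d <= p (1 - d) + (1 - p) / 2], i.e. [d <= 1/2], for each first letter. *)

Set Implicit Arguments. Unset Strict Implicit. Unset Printing Implicit Defensive.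
Import Order.TTheory GRing.Theory Num.Theory.
Import numFieldNormedType.Exports.
Local Open Scope ring_scope.

(** * Averages over random reduced continuations of a letter *)

Section RandomReducedWord.
Local Open Scope classical_set_scope.
Variables (R : realType) (k : nat).
Hypothesis k_gt0 : (0 < k)%N.
Implicit Types (c y : letter k) (u v w : seq (letter k)).
Implicit Types (f g : seq (letter k) -> R).

Let q : R := (k.*2.-1)%:R.

(** Mean of [f v] over the random words [v] of length [n] such that [c v] is
    reduced. *)
Fixpoint mean n f c : R :=
  if n is n'.+1 then q^-1 * \sum_(y | y != linv c) mean n' (fun v => f (y :: v)) y
  else f [::].

Lemma linvK : involutive (@linv k).
Proof. by case=> a b; rewrite /linv /= negbK. Qed.

Lemma linv_neq c : linv c != c.
Proof. by case: c => a b; rewrite xpair_eqE /= eqxx /=; case: b. Qed.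

Lemma card_letter : #|{: letter k}| = k.*2.
Proof. by rewrite card_prod card_ord card_bool muln2. Qed.

Lemma card_next c : #|[pred y | y != linv c]| = k.*2.-1.
Proof.
by rewrite (eq_card (B := predC1 (linv c))) // cardC1 card_letter.
Qed.

Lemma q_gt0 : 0 < q.
Proof. by rewrite ltr0n; case: (k) k_gt0. Qed.

Lemma sum_next c (a : R) : \sum_(y | y != linv c) a = q * a.
Proof. by rewrite sumr_const card_next mulr_natl. Qed.

(** Markov property: the past affects the continuation only through its last letter. This is why the
    law restarts after a hit. *)
Lemma mean_cat m n f c :
  mean (m + n) f c = mean m (fun u => mean n (fun v => f (u ++ v)) (last c u)) c.
Proof.
elim: m f c => [//|m IH] f c; rewrite addSn /=.
by congr (_ * _); apply: eq_bigr => y _; rewrite IH.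
Qed.

Lemma le_mean n f g c : (forall v, size v = n -> f v <= g v) ->
  mean n f c <= mean n g c.
Proof.
elim: n f g c => [|n IH] f g c fg /=; first exact: fg.
rewrite ler_wpM2l ?invr_ge0 ?ler0n //; apply: ler_sum => y _.
by apply: IH => v sv; apply: fg; rewrite /= sv.
Qed.

Lemma eq_mean n f g c : (forall v, size v = n -> f v = g v) ->
  mean n f c = mean n g c.
Proof.
by move=> fg; apply/eqP; rewrite eq_le !le_mean // => v sv; rewrite fg.
Qed.

Lemma meanD n f g c : mean n (fun v => f v + g v) c = mean n f c + mean n g c.
Proof.
elim: n f g c => [//|n IH] f g c /=.
by rewrite (eq_bigr _ (fun y _ => IH _ _ y)) big_split mulrDr.
Qed.

Lemma meanZ n a f c : mean n (fun v => a * f v) c = a * mean n f c.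
Proof.
elim: n f c => [//|n IH] f c /=.
by rewrite (eq_bigr _ (fun y _ => IH _ y)) -mulr_sumr mulrCA.
Qed.

Lemma meanB n f g c : mean n (fun v => f v - g v) c = mean n f c - mean n g c.
Proof.
rewrite -mulN1r -meanZ -meanD; apply: eq_mean => v _; by rewrite mulN1r.
Qed.

Lemma mean_cst n a c : mean n (fun=> a) c = a.
Proof.
elim: n c => [//|n IH] c /=; rewrite (eq_bigr _ (fun y _ => IH y)) sum_next.
by rewrite mulKf // gt_eqF // q_gt0.
Qed.

Lemma mean_sum n m (F : nat -> seq (letter k) -> R) c :
  mean n (fun v => \sum_(i < m) F i v) c = \sum_(i < m) mean n (F i) c.
Proof.
elim: m => [|m IH].
  by rewrite big_ord0 -[RHS](mean_cst n 0 c); apply: eq_mean => v _; rewrite big_ord0.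
rewrite big_ord_recr /= -IH -meanD; apply: eq_mean => v _; by rewrite big_ord_recr.
Qed.

Lemma mean_ge0 n f c : (forall v, 0 <= f v) -> 0 <= mean n f c.
Proof. by move=> f0; rewrite -[leLHS](mean_cst n 0 c); apply: le_mean. Qed.

(** * Layer counts and the measure in terms of averages *)

Lemma big_tuple_cons (T : finType) n (F : n.+1.-tuple T -> R) :
  \sum_t F t = \sum_x \sum_(t : n.-tuple T) F [tuple of x :: t].
Proof.
rewrite pair_bigA /=.
rewrite (reindex (fun p : T * n.-tuple T => [tuple of p.1 :: p.2])) //=.
exists (fun t => (thead t, [tuple of behead t])) => [[x t] _|t _] /=.
  by rewrite theadE; congr pair; apply: val_inj.
by rewrite [t in RHS]tuple_eta.
Qed.

Lemma sum_reduced_tuples n f c :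
  \sum_(t : n.-tuple (letter k)) (reduced (c :: t))%:R * f t = q ^+ n * mean n f c.
Proof.
elim: n f c => [|n IH] f c.
  rewrite (bigD1 [tuple]) //= big1 ?addr0 => [|t /eqP[]]; last exact: tuple0.
  by rewrite !mul1r.
rewrite big_tuple_cons /= exprSr -mulrA mulVKf ?gt_eqF ?q_gt0 //.
rewrite mulr_sumr [RHS]big_mkcond; apply: eq_bigr => y _ /=.
case: (y != linv c) => /=; last by rewrite big1 // => t _; rewrite mul0r.
by rewrite -IH.
Qed.

Lemma card_layerS n (A : set (seq (letter k))) :
  #|layer n.+1 A|%:R =
    q ^+ n * \sum_c mean n (fun v => (`[< A (c :: v) >])%:R) c :> R.
Proof.
rewrite mulr_sumr -sum1_card natr_sum big_mkcond big_tuple_cons /=.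
apply: eq_bigr => c _; rewrite -sum_reduced_tuples; apply: eq_bigr => t _.
rewrite inE /= -natrM mulnb.
by case: ifP.
Qed.

Lemma card_layer0 (A : set (seq (letter k))) : (#|layer 0 A| <= 1)%N.
Proof. by rewrite (leq_trans (max_card _)) // card_tuple expn0. Qed.

Lemma card_layer0_setT : #|layer 0 (@setT (seq (letter k)))| = 1%N.
Proof.
rewrite -[RHS](expn0 #|{: letter k}|) -card_tuple; apply: eq_card => t.
by rewrite !inE tuple0 asboolT.
Qed.

Lemma card_layerS_setT n :
  #|layer n.+1 (@setT (seq (letter k)))|%:R = q ^+ n * k.*2%:R :> R.
Proof.
rewrite card_layerS; congr (_ * _).
rewrite -card_letter -sum1_card natr_sum; apply: eq_bigr => c _.
by rewrite -[RHS](mean_cst n 1 c); apply: eq_mean => v _; rewrite asboolT.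
Qed.

Lemma mu_le_setT n : mu_le R (@setT (seq (letter k))) n = n.+1%:R.
Proof.
rewrite /mu_le (eq_bigr (fun=> 1)) ?sumr_const ?card_ord // => -[[|m] ?] _ /=.
  by rewrite card_layer0_setT divr1.
rewrite divff // card_layerS_setT mulf_neq0 ?expf_neq0 ?gt_eqF ?q_gt0 //.
by rewrite ltr0n double_gt0.
Qed.

(** Nonempty words are grouped by first letter, each letter carrying weight 1/(2k) in every layer;
    the leading 1 bounds the layer of the empty word. *)
Lemma mu_le_bound (A : set (seq (letter k))) n :
  mu_le R A n <=
    1 + k.*2%:R^-1 * \sum_c \sum_(m < n) mean m (fun v => (`[< A (c :: v) >])%:R) c.
Proof.
rewrite /mu_le big_ord_recl /= card_layer0_setT divr1; apply: lerD.
  by rewrite lern1 card_layer0.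
rewrite exchange_big /= mulr_sumr; apply: ler_sum => m _.
rewrite /bump /= add1n card_layerS card_layerS_setT.
set e := \sum_c _; have qm : q ^+ m != 0 by rewrite expf_neq0 // gt_eqF // q_gt0.
by rewrite invfM mulrACA divff // mul1r mulrC.
Qed.

(** * Decomposition at the first hit, for a fixed first letter *)

Section FirstHit.
Variables (B : pred (seq (letter k))) (c : letter k).
Hypothesis B_cat : forall u v, B u -> B v -> ~~ B (u ++ v).

(** No prefix of [u ++ v] of length at least [size u] lies in [B] and is
    followed by [c] within [u ++ v]; used with [u = [:: c]]. *)
Fixpoint nohit u v : bool :=
  if v is y :: v' then ~~ (B u && (y == c)) && nohit (rcons u y) v' else true.

Lemma nohit_cat u v w : nohit u (v ++ w) = nohit u v && nohit (u ++ v) w.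
Proof.
elim: v u => [|y v IH] u /=; first by rewrite cats0.
by rewrite IH cat_rcons andbA.
Qed.

Let nhit v : R := (nohit [:: c] v)%:R.
(* [n] does not count the first letter [c]: [occ n] is the probability that the
   prefix of length [n.+1] is in [B], [hit n] that it is the first hit. *)
Let occ n : R := mean n (fun v => (B (c :: v))%:R) c.
Let miss n : R := mean n nhit c.
Let hit n : R := miss n - miss n.+1.
Let back n : R := mean n (fun v => (nohit [:: c] v && (last c v == linv c))%:R) c.

(** A word [c :: v] that is in [B] and not yet hit becomes a hit for exactly one of its [q] next
    letters, namely [c], unless it ends in the inverse of [c], which forbids that letter. *)
Lemma hit_miss n : hit n =
  mean n (fun v => q^-1 *
    (nohit [:: c] v && B (c :: v) && (last c v != linv c))%:R) c.
Proof.
rewrite /hit /miss -[n.+1]addn1 mean_cat -meanB; apply: eq_mean => u _ /=.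
have q0 : q != 0 by rewrite gt_eqF // q_gt0.
apply: (mulfI q0); rewrite mulrBr !mulVKf //.
set l := last c u.
have -> : \sum_(y | y != linv l) nhit (u ++ [:: y]) =
  \sum_(y | y != linv l) nhit u -
  \sum_(y | y != linv l) (nohit [:: c] u && B (c :: u) && (y == c))%:R.
  rewrite -sumrB; apply: eq_bigr => y _; rewrite /nhit nohit_cat /= andbT.
  by case: nohit; case: (B _); case: (y == c); rewrite ?subr0 ?subrr.
rewrite sum_next opprB addrC subrK.
have -> : (l != linv c) = (c != linv l).
  by rewrite -{1}(linvK l) (inj_eq (inv_inj linvK)) eq_sym.
have [cl|cl] := boolP (c != linv l).
  rewrite (bigD1 c) //= eqxx !andbT big1 ?addr0 // => y /andP[_ /negPf ->].
  by rewrite andbF.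
rewrite andbF big1 // => y yl; case: eqP => [yc|]; last by rewrite andbF.
by rewrite yc (negPf cl) in yl.
Qed.

Lemma hit_ge0 n : 0 <= hit n.
Proof.
rewrite hit_miss; apply: mean_ge0 => v.
by rewrite mulr_ge0 ?invr_ge0 ?ler0n.
Qed.

Lemma miss_ge0 n : 0 <= miss n.
Proof. by apply: mean_ge0 => v; exact: ler0n. Qed.

Lemma miss_nonincreasing : nonincreasing_seq miss.
Proof. by apply/nonincreasing_seqP => n; rewrite -subr_ge0 hit_ge0. Qed.

Lemma occ_ge0 n : 0 <= occ n.
Proof. by apply: mean_ge0 => v; exact: ler0n. Qed.

Lemma occ_le1 n : occ n <= 1.
Proof. by rewrite -[leRHS](mean_cst n 1 c); apply: le_mean => v _; rewrite lern1 leq_b1. Qed.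

(** Summing over [i], the weights [nhit (take i v) - nhit (take i.+1 v)] select
    the prefix of [v] at which the first hit occurs. *)
Lemma mean_first_hit i j :
  mean (i + j.+1) (fun v => (B (c :: v))%:R * (nhit (take i v) - nhit (take i.+1 v))) c
  <= hit i * (1 - occ j).
Proof.
rewrite hit_miss mean_cat mulrC -meanZ; apply: le_mean => u su /=.
rewrite mulrCA ler_wpM2l ?invr_ge0 ?ler0n //.
have s1 : 0 <= 1 - occ j by rewrite subr_ge0 occ_le1.
set l := last c u.
have E y v : nhit (take i (u ++ y :: v)) - nhit (take i.+1 (u ++ y :: v)) =
   (nohit [:: c] u && B (c :: u) && (y == c))%:R.
  rewrite take_size_cat // take_cat su ltnNge leqnSn /= subSnn /= take0 /nhit.
  rewrite nohit_cat /= andbT.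
  by case: nohit; case: (B _); case: (y == c); rewrite ?subr0 ?subrr.
under eq_bigr => y _ do under eq_mean => v _ do rewrite E mulrC.
under eq_bigr => y _ do rewrite meanZ.
have -> : (l != linv c) = (c != linv l).
  by rewrite -{1}(linvK l) (inj_eq (inv_inj linvK)) eq_sym.
have [cl|cl] := boolP (c != linv l); last first.
  rewrite andbF mulr0 big1 // => y yl; case: eqP => [yc|]; last by rewrite andbF mul0r.
  by rewrite yc (negPf cl) in yl.
rewrite (bigD1 c) //= eqxx !andbT big1 ?addr0; last first.
  by move=> y /andP[_ /negPf ->]; rewrite andbF mul0r.
rewrite mulrC; have [/andP[_ Bu]|_] := boolP (_ && _); last by rewrite !mulr0.
rewrite !mulr1.
have -> : 1 - occ j = mean j (fun v => 1 - (B (c :: v))%:R) c by rewrite meanB mean_cst.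
(* Since [c :: u] is in [B], the words [c :: v] and [c :: u ++ c :: v] cannot both be in [B]. *)
apply: le_mean => v _.
case: (boolP (B (c :: v))) => Bv; last by rewrite subr0 lern1 leq_b1.
by rewrite -cat_cons (negPf (B_cat Bu Bv)) subrr.
Qed.

(** The sum covers a first hit before the end of the word. Otherwise the word is unhit: if it ends
    in the inverse of [c], it is counted by [back n]; if not, the next letter makes it a hit with
    probability [q^-1], whence [q * hit n]. *)
Lemma occ_le n :
  occ n <= \sum_(i < n) hit i * (1 - occ (n - i.+1)) + q * hit n + back n.
Proof.
pose F i v : R := (B (c :: v))%:R * (nhit (take i v) - nhit (take i.+1 v)).
have E v : size v = n ->
    (B (c :: v))%:R = \sum_(i < n) F i v + (B (c :: v))%:R * nhit v.
  move=> sv; rewrite -mulr_sumr -mulrDr.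
  have -> : \sum_(i < n) (nhit (take i v) - nhit (take i.+1 v)) = 1 - nhit v.
    rewrite -(big_mkord predT (fun i => nhit (take i v) - nhit (take i.+1 v))).
    rewrite -[LHS]opprK -sumrN.
    under eq_bigr => i _ do rewrite opprB.
    rewrite (telescope_sumr (fun i => nhit (take i v))) // opprB take0.
    by rewrite -sv take_size.
  by rewrite subrK mulr1.
rewrite {1}/occ (eq_mean c E) meanD mean_sum -addrA; apply: lerD.
  apply: ler_sum => i _.
  have {1}-> : n = (i + (n - i.+1).+1)%N by rewrite subnSK // subnKC // ltnW.
  exact: mean_first_hit.
rewrite hit_miss -meanZ -meanD; apply: le_mean => v _.
rewrite mulVKf ?gt_eqF ?q_gt0 // /nhit.
by case: nohit; case: (B _); case: (_ == _); rewrite ?mulr0 ?mulr1 ?mul0r ?addr0 ?add0r ?ler0n ?lexx.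
Qed.

Lemma back0 : back 0 = 0.
Proof. by rewrite /back /= eq_sym (negPf (linv_neq c)). Qed.

Lemma mean_rank1 n f : k = 1%N -> mean n f c = f (nseq n c).
Proof.
move=> k1; have yc (y : letter k) : (y != linv c) = (y == c).
  have ord0E (i : 'I_k) : i = 0%N :> nat.
    by have := ltn_ord i; rewrite [X in (_ < X)%N]k1; case: (nat_of_ord i).
  have : y.1 = c.1 by apply: val_inj; rewrite /= !ord0E.
  by case: y c => [a b] [a' b'] /= <-; rewrite /linv !xpair_eqE eqxx /=; case: b; case: b'.
have q1 : q = 1 by rewrite /q k1.
elim: n f => [//|n IH] f /=.
by rewrite (eq_bigl _ _ yc) big_pred1_eq IH q1 invr1 mul1r.
Qed.

(** At most one of the [q] next letters is the inverse of [c], and [q >= 3] once [k >= 2]. In rank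
    one [q = 1], but the word is then a power of [c] and the left side vanishes. *)
Lemma back_le n : back n.+1 <= miss n / 2.
Proof.
have [k1|k1] := eqVneq k 1%N.
  rewrite /back mean_rank1 //.
  have -> : last c (nseq n.+1 c) = c by rewrite /=; elim: n.
  by rewrite eq_sym (negPf (linv_neq c)) andbF divr_ge0 ?miss_ge0.
rewrite mulrC -meanZ /back -[n.+1]addn1 mean_cat; apply: le_mean => u _ /=.
have q2 : q^-1 <= 2^-1.
  rewrite lef_pV2 ?posrE ?q_gt0 // ler_nat.
  by case: (k) k_gt0 k1 => [|[|m]] //.
apply: (@le_trans _ _ (q^-1 * nhit u)); last by rewrite ler_wpM2r ?ler0n.
rewrite ler_wpM2l ?invr_ge0 ?ler0n //.
apply: (@le_trans _ _ (\sum_(y : letter k) nhit u * (y == linv c)%:R)).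
  rewrite [leRHS](bigID (fun y => y != linv (last c u))) /=.
  apply: ler_wpDr; first by apply: sumr_ge0 => y _; rewrite mulr_ge0 ?ler0n.
  apply: ler_sum => y _; rewrite /nhit nohit_cat last_cat /=.
  rewrite -natrM mulnb ler_nat; case: nohit => //=; case: (y == linv c).
    exact: leq_b1.
  by rewrite andbF.
rewrite (bigD1 (linv c)) //= eqxx mulr1 big1 ?addr0 // => y /negPf ->.
by rewrite mulr0.
Qed.

Lemma sum_occ_le N :
  \sum_(n < N) occ n <= N%:R / 2 + q + (\sum_(n < N) miss n - N%:R * miss N) / 2.
Proof.
have sum_hit n : \sum_(i < n) hit i = 1 - miss n.
  elim: n => [|n IH]; last by rewrite big_ord_recr IH /hit /=; ring.
  by rewrite big_ord0 /miss /= /nhit /= subrr.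
have conv : \sum_(n < N) \sum_(i < n) hit i * (1 - occ (n - i.+1)) <=
    (1 - miss N) * (N%:R - \sum_(n < N) occ n).
  rewrite -(big_mkord predT (fun n => \sum_(i < n) hit i * (1 - occ (n - i.+1)))).
  under eq_bigr => n _ do
    rewrite -(big_mkord predT (fun i => hit i * (1 - occ (n - i.+1)))).
  (* After exchanging the sums, a hit at [i] is weighted by the sum of [1 - occ j] over
     [j < N - i.+1], at most the full sum over [j < N]. *)
  rewrite -sum_hit mulr_suml -(big_mkord predT (fun i => hit i * _)).
  under eq_big_nat => n /andP[_ nN] do
    rewrite (big_nat_widen 0 n N) ?(ltnW nN) //.
  rewrite (exchange_big_dep_nat predT) //= big_nat_cond [leRHS]big_nat_cond.
  apply: ler_sum => i /andP[/andP[_ iN] _]; rewrite -mulr_sumr ler_wpM2l ?hit_ge0 //.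
  have -> : N%:R - \sum_(n < N) occ n = \sum_(0 <= n < N) (1 - occ n).
    by rewrite big_mkord sumrB sumr_const card_ord.
  rewrite [leLHS](_ : _ = \sum_(i.+1 <= n < N) (1 - occ (n - i.+1))); last first.
    by rewrite [RHS](big_nat_widenl _ 0).
  rewrite -{1}[i.+1]add0n big_addn.
  under eq_bigr => n _ do rewrite addnK.
  rewrite [leRHS](@big_cat_nat _ _ _ (N - i.+1)) ?leq_subr //=.
  by apply: ler_wpDr => //; apply: sumr_ge0 => n _; rewrite subr_ge0 occ_le1.
have sum_back_le : \sum_(n < N) back n <= (\sum_(n < N) miss n) / 2.
  (* The vanishing of [back 0] absorbs the index shift in [back_le]. *)
  case: (N) => [|M]; first by rewrite !big_ord0 mul0r.
  rewrite big_ord_recl back0 add0r mulr_suml big_ord_recr /=.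
  apply: ler_wpDr; [exact: divr_ge0 (miss_ge0 _) _|apply: ler_sum => n _; exact: back_le].
have main : \sum_(n < N) occ n <=
    (1 - miss N) * (N%:R - \sum_(n < N) occ n) + q * (1 - miss N) + (\sum_(n < N) miss n) / 2.
  apply: (le_trans (ler_sum _ (fun (n : 'I_N) _ => occ_le n))).
  rewrite !big_split /= -mulr_sumr sum_hit; apply: lerD => //; exact: lerD.
have missN_ge0 := miss_ge0 N.
have missN_le1 : miss N <= 1.
  by rewrite -[leRHS](mean_cst N 1 c); apply: le_mean => v _; rewrite lern1 leq_b1.
have missN_le : N%:R * miss N <= \sum_(n < N) miss n.
  rewrite mulr_natl -[X in _ *+ X](card_ord N) -sumr_const; apply: ler_sum => n _.
  exact: miss_nonincreasing (ltnW (ltn_ord n)).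
have q0 := q_gt0.
move: main missN_le; set A := \sum_(n < N) occ n; set SQ := \sum_(n < N) miss n => main missN_le.
(* [main] bounds [(2 - miss N) * A]. Multiplied by [2 - miss N], the goal exceeds that bound by
   exactly [q + (1 - miss N) * (SQ - N * miss N) / 2]. *)
rewrite -subr_ge0; have missN_lt2 : 0 < 2 - miss N by lra.
rewrite -(pmulr_rge0 _ missN_lt2).
have : 0 <= (1 - miss N) * ((SQ - N%:R * miss N) / 2) by apply: mulr_ge0; lra.
have : 0 <= q by lra.
nra.
Qed.

(** * Limit of the averaged bound *)

Lemma cvg_mean_correction :
  (fun n => 1 / 2 + q * n.+1%:R^-1 +
    (arithmetic_mean miss n - miss n.+1) / 2) @ \oo --> (1 / 2 : R).
Proof.
have /cvg_ex[l miss_l] : cvgn miss.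
  apply: nonincreasing_is_cvgn miss_nonincreasing _.
  by exists 0 => _ [n _ <-]; exact: miss_ge0.
(* The limit [l] may be positive; the correction vanishes because the Cesàro means of [miss] also
   tend to [l]. *)
rewrite [X in _ --> X](_ : _ = 1 / 2 + q * 0 + (l - l) / 2); last by rewrite subrr; ring.
apply: cvgD.
  by apply: cvgD; [exact: cvg_cst|apply: cvgMl_tmp; exact: cvg_harmonic].
by apply: cvgMr_tmp; apply: cvgB; [exact: cesaro|rewrite cvg_shiftS].
Qed.

Lemma mean_occ_le n : (\sum_(m < n) occ m) / n.+1%:R <=
  1 / 2 + q * n.+1%:R^-1 + (arithmetic_mean miss n - miss n.+1) / 2.
Proof.
have n0 : 0 < n.+1%:R :> R by rewrite ltr0n.
rewrite ler_pdivrMr //.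
(* One more term makes the number of summands equal to the denominator. *)
apply: (@le_trans _ _ (\sum_(m < n.+1) occ m)).
  by rewrite big_ord_recr /= lerDl occ_ge0.
apply: (le_trans (sum_occ_le _)).
rewrite /arithmetic_mean /series /= big_mkord le_eqVlt; apply/orP; left; apply/eqP.
by field; rewrite gt_eqF.
Qed.

End FirstHit.
End RandomReducedWord.

(** * Passage to the upper density *)

Lemma le_limn_esup (R : realType) (u v : nat -> \bar R) :
  (forall n, (u n <= v n)%E) -> (limn_esup u <= limn_esup v)%E.
Proof.
move=> uv; apply: le_ereal_inf_tmp => _ [V FV <-].
apply: (@le_trans _ _ (ereal_sup [set u x | x in V])).
  by apply: ereal_inf_lbound; exists V.
apply: ge_ereal_sup => _ [n Vn <-]; apply: (le_trans (uv n)).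
by apply: ereal_sup_ubound; exists n.
Qed.

(** Product-freeness is applied only to such products without cancellation. *)
Lemma fmul_reduced (k : nat) (u v : seq (letter k)) :
  reduced (u ++ v) -> fmul u v = u ++ v.
Proof.
elim: u => [//|x u IH] xuv; rewrite /= IH; last exact: path_sorted xuv.
by move: xuv; rewrite /reduced /=; case: (u ++ v) => //= y w /andP[/negPf ->].
Qed.

Theorem theorem1p1 (R : realType) (k : nat) (hk : (0 < k)%N)
    (S : set (seq (letter k)))
    (Sred : forall w, S w -> reduced w)
    (hS : product_free S) :
  (upper_density R S <= (1 / 2 : R)%:E)%E.
Proof.
pose B : pred (seq (letter k)) := fun w => `[< S w >].
have B_cat u v : B u -> B v -> ~~ B (u ++ v).
  move=> /asboolP Su /asboolP Sv; apply/negP => /asboolP Suv.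
  by apply: (hS _ _ _ Su Sv Suv); rewrite fmul_reduced //; exact: Sred.
pose bound c n : R := 1 / 2 + (k.*2.-1)%:R * n.+1%:R^-1 +
  (arithmetic_mean (fun m => mean m (fun v => (nohit B c [:: c] v)%:R) c) n
   - mean n.+1 (fun v => (nohit B c [:: c] v)%:R) c) / 2.
(* The first term pays for the empty word; the second averages over the 2k first letters. *)
pose v n : R := n.+1%:R^-1 + k.*2%:R^-1 * \sum_c bound c n.
have k2 : k.*2%:R != 0 :> R by rewrite pnatr_eq0 double_eq0 -lt0n.
have cvgv : (v @ \oo --> (1 / 2 : R))%classic.
  have -> : (1 / 2 : R) = 0 + k.*2%:R^-1 * \sum_(c : letter k) 1 / 2.
    rewrite sumr_const card_letter -(mulr_natl (1 / 2)) mulrA mulVf //.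
    by rewrite !mul1r add0r.
  apply: cvgD; first exact: cvg_harmonic.
  apply: cvgMl_tmp; apply: cvg_big => [|c _]; first exact: add_continuous.
  exact: (@cvg_mean_correction R k hk B c).
have mu_le_v n : mu_le R S n / mu_le R (@setT (seq (letter k))) n <= v n.
  rewrite mu_le_setT // ler_pdivrMr ?ltr0n // (le_trans (mu_le_bound _ hk _ _)) //.
  rewrite mulrDl mulVf ?pnatr_eq0 // lerD2l -mulrA ler_wpM2l ?invr_ge0 ?ler0n //.
  rewrite mulr_suml; apply: ler_sum => c _.
  rewrite -ler_pdivrMr ?ltr0n //; exact: mean_occ_le.
apply: (le_trans (le_limn_esup (v := fun n => (v n)%:E) _)).
  by move=> n; rewrite lee_fin.
have cvgv' : ((v n)%:E @[n --> \oo] --> (1 / 2 : R)%:E)%classic by apply: cvg_EFin; [exact: nearW|].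
by rewrite (cvg_limn_einf_sup cvgv').2.
Qed.
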